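(* Consider a family of ergodic, uniformly hyperbolic dynamical systems $\frac{du}{dt}=f(u,s)$ on $\mathbb{R}^n$ with scalar parameter $s$, with $f$ smooth in both arguments, and an observable $J(u,s)\in\mathbb{R}$ with uniformly continuous partial derivatives, satisfying the standing assumptions listed in the context. Fix $s$ and let $u(t)=u(t;s)$, $t\ge 0$, be a trajectory, and let $(v,\eta)$ be the uniformly bounded shadowing pair along it described in the context. Let $w:[0,1]\to\mathbb{R}$ be a function and, for each $T>0$, let $\check\tau=\check\tau(T)$ be a real number, such that: (1) $w$ is continuously differentiable; (2) $w(0)=w(1)=0$; (3) $\int_0^1 w(r)\,dr=1$; (4) $0\le\check\tau(T)\le T$ for all $T$, and $\lim_{T\to\infty}\check\tau(T)/T$ exists. For $0\le t\le T$ define $$\check v_{\check\tau}(t)=v(t)-f(u(t),s)\int_{\check\tau}^{t}\eta(r)\,dr .$$ Then $$\frac{d}{ds}\lim_{T\to\infty}\frac1T\int_0^T J(u(t;s),s)\,dt=\lim_{T\to\infty}\frac1T\int_0^T w\!\left(\tfrac{t}{T}\right)\bigl(J_u(u(t),s)\,\check v_{\check\tau}(t)+J_s(u(t),s)\bigr)\,dt ,$$ where in particular the limit on the right-hand side exists.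
   Context: Notation: $f_u,f_s,J_u,J_s$ denote partial derivatives, evaluated along the trajectory $(u(t),s)$; $J(t)$ denotes $J(u(t),s)$; $f(t)=f(u(t),s)=\frac{du}{dt}$. For a function $x:[0,\infty)\to\mathbb{R}$, $\langle x\rangle:=\lim_{T\to\infty}\frac1T\int_0^T x(t)\,dt$ when this limit exists. Ergodicity means that the infinite-time average $\langle J\rangle(s)=\lim_{T\to\infty}\frac1T\int_0^T J(u(t;s),s)\,dt$ exists and does not depend on the initial condition $u(0;s)$. Standing assumptions (those of the original Least Squares Shadowing method; the essential one is uniform hyperbolicity). Along the trajectory, $f$, $J$, $J_u$, $J_s$ are bounded. By the shadowing lemma there is a pair consisting of a differentiable function $v:[0,\infty)\to\mathbb{R}^n$ and a (locally integrable) scalar function $\eta:[0,\infty)\to\mathbb{R}$ (the time dilation), both uniformly bounded in time, satisfying $$\frac{dv}{dt}=f_u\,v+f_s+\eta f .$$ The time averages $\langle J_u v\rangle$, $\langle J_s\rangle$, $\langle\eta J\rangle$, $\langle\eta\rangle$, $\langle J\rangle$ exist, and the following formula from earlier literature is taken as known: $\langle J\rangle$ is differentiable in $s$ and $$\frac{d\langle J\rangle}{ds}=\langle J_u v\rangle+\langle J_s\rangle+\langle\eta J\rangle-\langle\eta\rangle\langle J\rangle .$$ *)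

(* Defs.v *)
(* MathComp-Analysis; the reals are an arbitrary [R : realType], and integrals
   are Lebesgue integrals. *)
From HB Require Import structures.
From mathcomp Require Export all_boot all_order all_algebra.
From mathcomp Require Export all_classical all_reals all_analysis.

Set Implicit Arguments.
Unset Strict Implicit.
Unset Printing Implicit Defensive.

Import Order.TTheory GRing.Theory Num.Theory.
Import numFieldNormedType.Exports.

Local Open Scope classical_set_scope.
Local Open Scope ring_scope.

Section Calculus.
Context {R : realType}.

(* The difference quotient only uses points of [D], so that derivatives at the
   end points of an interval are one-sided. *)
Definition has_deriv_within {V : normedModType R} (D : set R) (g : R -> V)
    (t : R) (l : V) : Prop :=
  h^-1 *: (g (t + h) - g t) @[h --> within [set h | D (t + h)] 0^'] --> l.

(* For finite-dimensional [V], C^k in the usual sense: all the directional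
   derivatives are C^(k-1). *)
Fixpoint class_C {V W : normedModType R} (k : nat) (g : V -> W) : Prop :=
  if k is k'.+1 then
    (forall x, differentiable g x) /\ (forall h, class_C k' (fun x => 'D_h g x))
  else continuous g.

Definition smooth {V W : normedModType R} (g : V -> W) : Prop :=
  forall k, class_C k g.

Definition C1_on (D : set R) (g : R -> R) : Prop :=
  exists g' : R -> R,
    (forall t, D t -> has_deriv_within D g t (g' t)) /\
    {within D, continuous g'}.

(* The integral from [a] to [b], with its sign when [b < a]. *)
Definition oriented_integral (a b : R) (x : R -> R) : R :=
  if a <= b then (\int[lebesgue_measure]_(r in `[a, b]) x r)%R
  else - (\int[lebesgue_measure]_(r in `[b, a]) x r)%R.

Definition running_mean (x : R -> R) (T : R) : R :=
  T^-1 * (\int[lebesgue_measure]_(t in `[0, T]) x t)%R.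

Definition has_time_average (x : R -> R) : Prop :=
  cvg (running_mean x T @[T --> +oo]).

Definition time_average (x : R -> R) : R :=
  lim (running_mean x T @[T --> +oo]).

Definition bounded_in_time {V : normedModType R} (x : R -> V) : Prop :=
  exists M : R, forall t, 0 <= t -> `|x t| <= M.

Definition locally_integrable_in_time (x : R -> R) : Prop :=
  forall T, 0 <= T -> lebesgue_measure.-integrable `[0, T] (EFin \o x).

End Calculus.

Section Partials.
Context {R : realType} {n : nat} {W : normedModType R}.
Implicit Types (g : 'rV[R]_n -> R -> W) (x h : 'rV[R]_n) (s : R).

(* [d_u g x s h] is g_u(x, s) h and [d_s g x s] is g_s(x, s). *)
Definition d_u g x s h : W := 'd (fun y => g y s) x h.
Definition d_s g x s : W := derive1 (g x) s.

(* As R^n is finite-dimensional, uniform continuity of g_u as a linear-map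
   valued function is uniform continuity of g_u h for each fixed h. *)
Definition unif_continuous_partials g : Prop :=
  [/\ forall x s, differentiable (fun y => g y s) x,
      forall x s, derivable (g x) s 1,
      forall h, unif_continuous (fun p : 'rV[R]_n * R => d_u g p.1 p.2 h)
    & unif_continuous (fun p : 'rV[R]_n * R => d_s g p.1 p.2)].

End Partials.

Section Dynamics.
Context {R : realType} {n : nat}.
Implicit Types (f : 'rV[R]_n -> R -> 'rV[R]_n) (J : 'rV[R]_n -> R -> R).
Implicit Types (u p y v : R -> 'rV[R]_n) (s : R).

Definition solution_on (D : set R) f s u : Prop :=
  forall t, D t -> has_deriv_within D u t (f (u t) s).

Definition trajectory f s u : Prop := solution_on `[0, +oo[ f s u.

Definition ergodic f J : Prop :=
  forall s, exists a : R, forall u, trajectory f s u ->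
    running_mean (fun t => J (u t) s) T @[T --> +oo] --> a.

(* If [phi] is the flow, y(t) = D(phi^t)(p 0) (y 0). *)
Definition tangent_solution f s p y : Prop :=
  forall t, has_deriv_within setT y t (d_u f (p t) s (y t)).

(* The tangent space at a point x of [L] splits into a stable subspace [Es x],
   a neutral one spanned by the vector field, and an unstable one [Eu x]; the
   tangent flow transports [Es] and [Eu], with uniform exponential rates. The
   neutral subspace is trivial at an equilibrium, which is then a hyperbolic
   equilibrium. *)
Definition hyperbolic_set f s (L : set 'rV[R]_n) : Prop :=
  [/\ compact L,
      L !=set0,
      forall x, L x -> exists p,
        [/\ p 0 = x, solution_on setT f s p & forall t, L (p t)]
    & exists (C lambda : R) (Es Eu : 'rV[R]_n -> {vspace 'rV[R]_n}),
      [/\ 0 < C /\ 0 < lambda,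
          forall x, L x -> (Es x + <[f x s]> + Eu x)%VS = fullv /\
            directv (Es x + <[f x s]> + Eu x),
          forall p y, solution_on setT f s p -> (forall t, L (p t)) ->
            tangent_solution f s p y -> y 0 \in Es (p 0) ->
            (forall t, y t \in Es (p t)) /\
            (forall t, 0 <= t -> `|y t| <= C * expR (- lambda * t) * `|y 0|)
        & forall p y, solution_on setT f s p -> (forall t, L (p t)) ->
            tangent_solution f s p y -> y 0 \in Eu (p 0) ->
            (forall t, y t \in Eu (p t)) /\
            (forall t, t <= 0 -> `|y t| <= C * expR (lambda * t) * `|y 0|)]].

(* A compact uniformly hyperbolic set attracts every trajectory. *)
Definition uniformly_hyperbolic f : Prop :=
  forall s, exists L : set 'rV[R]_n, hyperbolic_set f s L /\
    forall u, trajectory f s u ->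
      forall e : R, 0 < e ->
        \forall t \near +oo, exists2 x, L x & `|u t - x| < e.

Definition shadowing_pair f s u v (eta : R -> R) : Prop :=
  [/\ bounded_in_time v, bounded_in_time eta, locally_integrable_in_time eta
    & forall t, 0 <= t ->
        has_deriv_within `[0, +oo[ v t
          (d_u f (u t) s (v t) + d_s f (u t) s + eta t *: f (u t) s)].

Definition v_check f s u v (eta : R -> R) (tau t : R) : 'rV[R]_n :=
  v t - oriented_integral tau t eta *: f (u t) s.

End Dynamics.

(* Main.v *)
Require Import Defs.
From mathcomp Require Import measurable_realfun ring lra.
Set Implicit Arguments.
Unset Strict Implicit.
Unset Printing Implicit Defensive.

Import Order.TTheory GRing.Theory Num.Theory.
Import numFieldNormedType.Exports.
Local Open Scope classical_set_scope.
Local Open Scope ring_scope.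

(** Write j(t) = J(u(t), s) and let H be the primitive of eta that vanishes at 0.
    By the chain rule, J_u applied to the modified shadowing direction is
    J_u v - (H(t) - H(tau)) j'(t), so that the weighted average to be computed is
    that of J_u v + J_s - (H(t) - H(tau)) j'(t), and the only unfamiliar term is
    the last one: H may grow linearly, so that H j' need not be bounded.

    The function w(t / T) j(t) vanishes at both ends of [0, T]. Integrating by
    parts against H ([weighted_by_parts]) therefore leaves no boundary term, kills
    the constant H(tau), and trades - w(t / T) (H(t) - H(tau)) j'(t) for
    w(t / T) eta(t) j(t) + w'(t / T) j(t) (H(t) - H(tau)) / T.
    Since eta has a mean h, H(t) = h t + o(T) uniformly on [0, T]
    ([primitive_linear_growth]), and the last summand may be replaced by
    h w'(t / T) (t / T - c) j(t), where c is the limit of tau / T.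

    All the terms are now of the form g(t / T) x(t) with g continuous on [0, 1]
    and x bounded with a mean m; the mean of such a product tends to m times the
    integral of g ([weighted_mean]). The weight w has integral 1, and w'(r) (r - c)
    has integral -1 whatever c is, because w vanishes at 0 and 1. The limit is thus
    the sum of the means of J_u v, J_s and eta J, minus the mean of eta times that
    of J, which is the known derivative of the mean of J. *)

(** * Integrals of bounded measurable functions over a segment *)

Section BoundedMeasurable.
Context {R : realType}.
Implicit Types (a b c : R) (x y : R -> R).

Definition integral_on a b x : R := \int[lebesgue_measure]_(t in `[a, b]) x t.

(** Unlike integrability, this condition is stable under products; every integrand
    below is built from such functions by ring operations. *)
Definition bounded_measurable a b x : Prop :=
  measurable_fun (`[a, b] : set R) x /\
  exists M, forall t, a <= t <= b -> `|x t| <= M.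

Lemma bounded_measurableS a b c d x : a <= c -> d <= b ->
  bounded_measurable a b x -> bounded_measurable c d x.
Proof.
move=> ac db [mx [M xM]]; split.
  apply: measurable_funS mx => //; apply: subset_itv; rewrite bnd_simp//.
by exists M => t /andP[ct td]; apply: xM; rewrite (le_trans ac)//= (le_trans td).
Qed.

Lemma bounded_measurable_cst a b (k : R) : bounded_measurable a b (fun=> k).
Proof. by split; [exact: measurable_cst | exists `|k|]. Qed.

Lemma bounded_measurableD a b x y : bounded_measurable a b x ->
  bounded_measurable a b y -> bounded_measurable a b (fun t => x t + y t).
Proof.
move=> [mx [M xM]] [my [N yN]]; split; first exact: measurable_funD.
exists (M + N) => t abt; apply: le_trans (ler_normD _ _) _.
by rewrite lerD ?xM ?yN.
Qed.

Lemma bounded_measurableM a b x y : bounded_measurable a b x ->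
  bounded_measurable a b y -> bounded_measurable a b (fun t => x t * y t).
Proof.
move=> [mx [M xM]] [my [N yN]]; split; first exact: measurable_funM.
by exists (M * N) => t abt; rewrite normrM ler_pM ?xM ?yN.
Qed.

Lemma bounded_measurableB a b x y : bounded_measurable a b x ->
  bounded_measurable a b y -> bounded_measurable a b (fun t => x t - y t).
Proof.
move=> bx by_; rewrite (_ : (fun _ => _) = (fun t => x t + -1 * y t)).
  apply: bounded_measurableD => //; apply: bounded_measurableM => //.
  exact: bounded_measurable_cst.
by apply/funext => t; rewrite mulN1r.
Qed.

Lemma bounded_measurable_within a b x :
  {within `[a, b], continuous x} -> bounded_measurable a b x.
Proof.
move=> cx; split; first exact: subspace_continuous_measurable_fun.
have /compact_bounded[M [_ xM]] : compact (x @` `[a, b]).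
  exact: continuous_compact (@segment_compact _ _ _).
exists (M + 1) => t abt; apply: (xM (M + 1)); first by rewrite ltrDl.
by exists t => //=; rewrite in_itv.
Qed.

Lemma bounded_measurable_continuous a b x :
  continuous x -> bounded_measurable a b x.
Proof.
by move=> cx; apply: bounded_measurable_within; exact: continuous_subspaceT.
Qed.

Lemma bounded_measurable_integrable a b x : bounded_measurable a b x ->
  lebesgue_measure.-integrable `[a, b] (EFin \o x).
Proof.
move=> [mx [M xM]]; apply: measurable_bounded_integrable => //.
  exact/compact_finite_measure/segment_compact.
exists M; split; first exact: num_real.
move=> N MN t /=; rewrite in_itv/= => abt; exact: le_trans (xM _ abt) (ltW MN).
Qed.

Lemma eq_integral_on a b x y :
  (forall t, a <= t <= b -> x t = y t) -> integral_on a b x = integral_on a b y.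
Proof.
by move=> xy; apply: eq_Rintegral => t; rewrite inE/= in_itv/=; exact: xy.
Qed.

Lemma integral_on_set1 a x : integral_on a a x = 0.
Proof. by rewrite /integral_on set_itv1 Rintegral_set1. Qed.

Lemma integral_on_cst a b (k : R) :
  a <= b -> integral_on a b (fun=> k) = k * (b - a).
Proof.
move=> ab; rewrite /integral_on Rintegral_cst//= lebesgue_measure_itv/=.
by rewrite lte_fin; case: ltgtP ab => // ->; rewrite subrr.
Qed.

Lemma integral_onD a b x y : bounded_measurable a b x ->
  bounded_measurable a b y ->
  integral_on a b (fun t => x t + y t) = integral_on a b x + integral_on a b y.
Proof.
by move=> bx by_; apply: RintegralD => //; exact: bounded_measurable_integrable.
Qed.

Lemma integral_onB a b x y : bounded_measurable a b x ->
  bounded_measurable a b y ->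
  integral_on a b (fun t => x t - y t) = integral_on a b x - integral_on a b y.
Proof.
by move=> bx by_; apply: RintegralB => //; exact: bounded_measurable_integrable.
Qed.

Lemma integral_onZ a b (k : R) x : bounded_measurable a b x ->
  integral_on a b (fun t => k * x t) = k * integral_on a b x.
Proof.
by move=> bx; apply: RintegralZl => //; exact: bounded_measurable_integrable.
Qed.

Lemma integral_on_split a b c x : a <= b -> b <= c ->
  bounded_measurable a c x ->
  integral_on a c x = integral_on a b x + integral_on b c x.
Proof.
move=> ab bc bx.
have ix := bounded_measurable_integrable bx.
have := @Rintegral_itvB _ x (BLeft a) (BRight c) b ix.
rewrite !bnd_simp => /(_ ab bc).
rewrite (@Rintegral_itv_obnd_cbnd _ b (BRight c)) => [E|].
  by rewrite /integral_on -E addrC subrK.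
apply: integrableS ix => //; apply: subset_itv; rewrite bnd_simp//.
Qed.

Lemma integral_on_norm_le a b x M : a <= b -> bounded_measurable a b x ->
  (forall t, a <= t <= b -> `|x t| <= M) ->
  `|integral_on a b x| <= M * (b - a).
Proof.
move=> ab bx xM; rewrite -integral_on_cst//.
apply: le_trans (le_normr_Rintegral _ (bounded_measurable_integrable bx)) _ => //.
apply: le_Rintegral => //.
- apply: (bounded_measurable_integrable (x := fun t => `|x t|)).
  case: bx => mx [K xK]; split; first exact: measurableT_comp mx.
  by exists K => t abt; rewrite normr_id xK.
- have := bounded_measurable_cst a b M; exact: bounded_measurable_integrable.
Qed.

Lemma primitive_increment T x (u r : R) : bounded_measurable 0 T x ->
  0 <= u -> u <= r -> r <= T ->
  integral_on 0 r x - integral_on 0 u x = integral_on u r x.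
Proof.
move=> bx u0 ur rT; rewrite (@integral_on_split 0 u r)//.
  by rewrite addrAC subrr add0r.
exact: bounded_measurableS bx.
Qed.

Lemma bounded_measurable_primitive T x : 0 <= T -> bounded_measurable 0 T x ->
  bounded_measurable 0 T (fun t => integral_on 0 t x).
Proof.
move=> T0 bx; apply: bounded_measurable_within.
apply: parameterized_integral_continuous => //.
exact: bounded_measurable_integrable.
Qed.

Lemma FTC2_integral_on (F F' : R -> R) a b : a <= b ->
  continuous F -> continuous F' ->
  (forall t, a < t < b -> is_derive t 1 F (F' t)) ->
  integral_on a b F' = F b - F a.
Proof.
rewrite le_eqVlt => /predU1P[<-|ab] cF cF' dF.
  by rewrite integral_on_set1 subrr.
rewrite /integral_on /Rintegral (@continuous_FTC2 _ F' F)//.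
- exact: continuous_subspaceT.
- split.
  + by move=> t; rewrite in_itv/= => /dF[].
  + exact/cvg_at_right_filter/cF.
  + exact/cvg_at_left_filter/cF.
- by move=> t; rewrite in_itv/= => /dF[_ <-]; rewrite derive1E.
Qed.

End BoundedMeasurable.

(** * Integration by parts for primitives of bounded functions *)

Section Subdivision.
Context {R : realType}.
Implicit Types (F : R -> R) (T e C : R).

Lemma subdivision_increment F T e (N : nat) :
  (forall k, (k < N.+1)%N ->
     `|F (T * (k.+1%:R / N.+1%:R)) - F (T * (k%:R / N.+1%:R))| <= e) ->
  `|F T - F 0| <= N.+1%:R * e.
Proof.
move=> dF.
suff : forall k, (k <= N.+1)%N -> `|F (T * (k%:R / N.+1%:R)) - F 0| <= k%:R * e.
  by move=> /(_ _ (leqnn _)); rewrite divff ?mulr1.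
elim=> [_|k IH kN]; first by rewrite mul0r mulr0 subrr normr0 mul0r.
rewrite -(subrKA (F (T * (k%:R / N.+1%:R)))) (le_trans (ler_normD _ _))//.
have -> : k.+1%:R * e = e + k%:R * e by rewrite -natr1; ring.
by apply: lerD; [exact: dF | apply: IH; exact: ltnW].
Qed.

(** Cutting [0, T] into N pieces bounds the total increment by a multiple of 1 / N,
    for every N. *)
Lemma quadratic_increments F T C : 0 <= T ->
  (forall a b, 0 <= a -> a <= b -> b <= T -> `|F b - F a| <= C * (b - a) ^+ 2) ->
  F T = F 0.
Proof.
move=> T0 dF; apply/eqP; rewrite -subr_eq0 -normr_le0.
apply/ler_addgt0Pr => e e0; rewrite add0r.
have [N NE] : exists N : nat, `|C| * T ^+ 2 / e < N.+1%:R.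
  exists (Num.truncn (`|C| * T ^+ 2 / e)); exact: truncnS_gt.
have N0 : (0 : R) < N.+1%:R by [].
apply: (le_trans (@subdivision_increment F T (`|C| * (T / N.+1%:R) ^+ 2) N _)).
  move=> k kN; apply: le_trans (dF _ _ _ _ _) _.
  - by rewrite mulr_ge0// divr_ge0.
  - by rewrite ler_wpM2l// ler_pM2r ?invr_gt0// ler_nat.
  - by rewrite ler_piMr// ler_pdivrMr// mul1r ler_nat.
  - rewrite -mulrBr -mulrBl -natr1 addrAC subrr add0r mul1r.
    by rewrite ler_wpM2r ?exprn_ge0 ?ler_norm// divr_ge0.
have {}NE : `|C| * T ^+ 2 < N.+1%:R * e by rewrite -ltr_pdivrMr.
rewrite expr_div_n mulrCA expr2 (_ : _ * _ = `|C| * T ^+ 2 / N.+1%:R); last first.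
  by field; lra.
by rewrite ler_pdivrMr// (mulrC e) ltW.
Qed.

End Subdivision.

Section PrimitivesByParts.
Context {R : realType}.

(** The primitives A and B are Lipschitz, possibly not differentiable everywhere.
    The defect Phi of the formula on [0, t] has quadratic increments: on [x, y] it
    changes by the integral of a (B - B(y)) + (A - A(x)) b, whose two factors A
    and B have moved by O(y - x) only. *)
Lemma integration_by_parts_primitives (T : R) (a b : R -> R) : 0 <= T ->
  bounded_measurable 0 T a -> bounded_measurable 0 T b ->
  integral_on 0 T (fun t => a t * integral_on 0 t b) +
  integral_on 0 T (fun t => integral_on 0 t a * b t) =
  integral_on 0 T a * integral_on 0 T b.
Proof.
move=> T0 ba bb.
pose A t := integral_on 0 t a; pose B t := integral_on 0 t b.
have bA : bounded_measurable 0 T A by exact: bounded_measurable_primitive.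
have bB : bounded_measurable 0 T B by exact: bounded_measurable_primitive.
have [_ [Ma aM]] := ba; have [_ [Mb bM]] := bb.
have Ma0 : 0 <= Ma by apply: le_trans (aM 0 _); rewrite ?lexx.
have Mb0 : 0 <= Mb by apply: le_trans (bM 0 _); rewrite ?lexx.
pose Phi t := integral_on 0 t (fun r => a r * B r) +
  integral_on 0 t (fun r => A r * b r) - A t * B t.
suff : Phi T = Phi 0.
  rewrite /Phi /A /B !integral_on_set1 mulr0 subr0 addr0 => /eqP.
  by rewrite subr_eq0 => /eqP.
apply: (@quadratic_increments _ _ _ (2 * (Ma * Mb))) => // x y x0 xy yT.
have sub z : bounded_measurable 0 T z -> bounded_measurable x y z.
  exact: bounded_measurableS.
have baB := bounded_measurableM ba bB.
have bAb := bounded_measurableM bA bb.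
have -> : Phi y - Phi x = integral_on x y (fun r => a r * (B r - B y)) +
                          integral_on x y (fun r => (A r - A x) * b r).
  rewrite (_ : (fun r => a r * (B r - B y)) = (fun r => a r * B r - B y * a r)).
    rewrite (_ : (fun r => (A r - A x) * b r) = (fun r => A r * b r - A x * b r)).
      have bBa := bounded_measurableM (bounded_measurable_cst x y (B y)) (sub _ ba).
      have bAxb := bounded_measurableM (bounded_measurable_cst x y (A x)) (sub _ bb).
      rewrite !integral_onB ?integral_onZ; try exact: sub; try by [].
      rewrite -(primitive_increment baB)// -(primitive_increment bAb)//.
      rewrite -(primitive_increment ba)// -(primitive_increment bb)//.
      by rewrite /Phi -/(A y) -/(A x) -/(B y) -/(B x); ring.
    by apply/funext => r; ring.
  by apply/funext => r; ring.
have incr z M : bounded_measurable 0 T z ->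
    (forall t, 0 <= t <= T -> `|z t| <= M) -> forall u r,
    x <= u -> u <= r -> r <= y ->
    `|integral_on 0 r z - integral_on 0 u z| <= M * (y - x).
  move=> bz zM u r xu ur ry.
  have M0 : 0 <= M by apply: le_trans (zM 0 _); rewrite ?lexx.
  have u0 := le_trans x0 xu; have rT := le_trans ry yT.
  rewrite (primitive_increment bz)//.
  apply: (@le_trans _ _ (M * (r - u))); last by rewrite ler_wpM2l// lerB.
  apply: integral_on_norm_le => //; first exact: bounded_measurableS bz.
  by move=> t /andP[ut tr]; rewrite zM// (le_trans u0)//= (le_trans tr).
have in0T t : x <= t <= y -> 0 <= t <= T.
  by move=> /andP[xt ty]; rewrite (le_trans x0)//= (le_trans ty).
have bBc := bounded_measurableB bB (bounded_measurable_cst 0 T (B y)).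
have bAc := bounded_measurableB bA (bounded_measurable_cst 0 T (A x)).
rewrite (le_trans (ler_normD _ _))//.
rewrite (_ : 2 * _ * _ = Ma * (Mb * (y - x)) * (y - x) +
                         (Ma * (y - x)) * Mb * (y - x)); last by ring.
apply: lerD; apply: integral_on_norm_le => //.
- exact/sub/(bounded_measurableM ba bBc).
- move=> t /[dup] /in0T tT /andP[xt ty]; rewrite normrM ler_pM ?aM// distrC.
  exact: incr.
- exact/sub/(bounded_measurableM bAc bb).
- move=> t /[dup] /in0T tT /andP[xt ty]; rewrite normrM ler_pM ?bM//.
  exact: incr.
Qed.

End PrimitivesByParts.

(** * Weighted time averages *)

Section WeightedMeans.
Context {R : realType}.
Implicit Types (x g : R -> R) (m M : R).

Definition bounded_signal x M : Prop :=
  (forall T, bounded_measurable 0 T x) /\ (forall t, 0 <= t -> `|x t| <= M).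

Lemma bounded_signal_ge0 x M : bounded_signal x M -> 0 <= M.
Proof. by move=> [_ xM]; apply: le_trans (xM 0 _). Qed.

(** Convergence of the means controls the late times t; at the early ones the
    primitive is bounded, hence negligible with respect to T. *)
Lemma primitive_linear_growth x m M : bounded_signal x M ->
  running_mean x T @[T --> +oo] --> m ->
  forall d : R, 0 < d -> \forall T \near +oo,
    forall t, 0 <= t <= T -> `|integral_on 0 t x - m * t| <= d * T.
Proof.
move=> bx xm d d0; have M0 := bounded_signal_ge0 bx; have [mx xM] := bx.
(* Up to B the crude bound (M + |m|) B is used, and past B the convergence of the
   means. *)
have [A [_ AP]] : \forall T \near +oo, `|m - running_mean x T| <= d.
  by move/cvgrPdist_le : xm; apply.
pose B := Num.max 1 (A + 1).
have B0 : 0 < B by rewrite lt_max ltr01.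
have AB : A < B by rewrite lt_max ltrDl ltr01 orbT.
near=> T => t /andP[t0 tT].
have BT : (M + `|m|) * B <= d * T.
  by rewrite -ler_pdivrMl//; near: T; apply: nbhs_pinfty_ge; rewrite num_real.
have [tB|Bt] := leP t B.
  apply: le_trans (ler_normB _ _) (le_trans _ BT).
  rewrite mulrDl lerD//.
    apply: (@le_trans _ _ (M * (t - 0))); last by rewrite subr0 ler_wpM2l.
    by apply: integral_on_norm_le => // r /andP[r0 _]; exact: xM.
  by rewrite normrM (ger0_norm t0) ler_wpM2l.
have t_gt0 := lt_trans B0 Bt.
rewrite (_ : _ - _ = t * (running_mean x t - m)); last first.
  by rewrite /running_mean -/(integral_on 0 t x); field; lra.
rewrite normrM (ger0_norm t0) mulrC.
apply: (@le_trans _ _ (d * t)); last by rewrite ler_pM2l.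
by rewrite ler_wpM2r// distrC AP// (lt_trans AB).
Unshelve. all: end_near. Qed.

(** Heine's theorem on [0, 1]; the second point may leave the interval, which
    spares a side condition. *)
Lemma unit_interval_modulus g : continuous g ->
  forall e : R, 0 < e -> exists N : nat, forall a b,
    0 <= a <= 1 -> `|a - b| <= N.+1%:R^-1 -> `|g a - g b| <= e.
Proof.
move=> cg e e0.
have /compact_near_coveringP/(_ R 0^'+
    (fun d a => forall b, `|a - b| <= d -> `|g a - g b| <= e) _) :=
  @segment_compact R 0 1.
case=> [z _|d /= d0 dP].
  have [d /= d0 dP] : \forall y \near z, `|g z - g y| <= e / 2.
    by move/cvgrPdist_le : (cg z); apply; rewrite divr_gt0.
  near=> a r => b abr.
  have za : `|z - a| < d / 2.
    by near: a; exists (d / 2) => //=; rewrite divr_gt0.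
  have rd : r < d / 2 by near: r; apply: nbhs_right_lt; rewrite divr_gt0.
  rewrite (splitr e) -(subrKA (g z)) (le_trans (ler_normD _ _))//.
  rewrite lerD//; first by rewrite distrC; apply: dP => /=; lra.
  apply: dP => /=; rewrite -(subrKA a) (le_lt_trans (ler_normD _ _))//.
  by rewrite [ltRHS]splitr ltrD// (le_lt_trans abr).
have [N dN] : exists N : nat, d^-1 < N.+1%:R.
  exists (Num.truncn d^-1); exact: truncnS_gt.
exists N => a b a01 abN; apply: (dP (N.+1%:R^-1)) => //=.
- rewrite sub0r normrN ger0_norm ?invr_ge0//.
  by rewrite invf_plt ?posrE//.
Unshelve. all: end_near. Qed.

Lemma continuous_rescale (T : R) g :
  continuous g -> continuous (fun t : R => g (t / T)).
Proof.
move=> cg t; apply: (@continuous_comp _ _ _ (fun t : R => t / T) g).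
  exact: mulrr_continuous.
exact: cg.
Qed.

(** On a short interval [a T, b T] the weight is nearly g(a), and the primitive of x
    increases by nearly m (b - a) T. The subdivision of [0, 1] is chosen first, from
    the modulus of continuity of g; then T is large enough for the errors of the
    finitely many pieces to be small together. *)
Lemma weighted_mean g x m M : continuous g -> bounded_signal x M ->
  running_mean x T @[T --> +oo] --> m ->
  running_mean (fun t => g (t / T) * x t) T @[T --> +oo] -->
    m * integral_on 0 1 g.
Proof.
move=> cg bx xm; have M0 := bounded_signal_ge0 bx; have [mx xM] := bx.
have [_ [K gK]] := bounded_measurable_continuous 0 1 cg.
have K0 : 0 <= K by apply: le_trans (gK 0 _); rewrite ?lexx ?ler01.
apply/cvgrPdist_le => e e0.
(* The errors of all the pieces add up to e' (M + |m|) from freezing the weight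
   and to 2 K d N.+1 from the growth of the primitive; each is at most e / 2. *)
pose e' := e / (2 * (M + `|m| + 1)).
have D0 : 0 < M + `|m| + 1 by rewrite ltr_wpDl// addr_ge0.
have e'0 : 0 < e' by rewrite divr_gt0// mulr_gt0.
have [N modN] := unit_interval_modulus cg e'0.
have N0 : (0 : R) < N.+1%:R by [].
pose d := e / (4 * (K + 1) * N.+1%:R).
have K1 : 0 < K + 1 by rewrite ltr_wpDl.
have d0 : 0 < d by rewrite divr_gt0// !mulr_gt0.
near=> T.
have T0 : 0 < T by near: T; apply: nbhs_pinfty_gt; rewrite num_real.
have growth : forall t, 0 <= t <= T -> `|integral_on 0 t x - m * t| <= d * T.
  by near: T; exact: primitive_linear_growth bx xm _ d0.
pose X t := integral_on 0 t x.
have cgT := continuous_rescale (T := T) cg.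
have bgT a b := bounded_measurable_continuous a b cgT.
have bg a b := bounded_measurable_continuous a b cg.
have bgx S := bounded_measurableM (bgT 0 S) (mx S).
pose D b := T^-1 * integral_on 0 (b * T) (fun t => g (t / T) * x t) -
            m * integral_on 0 b g.
have D0E : D 0 = 0 by rewrite /D mul0r !integral_on_set1 !mulr0 subrr.
rewrite distrC.
rewrite (_ : _ - _ = D 1 - D 0); last by rewrite D0E subr0 /D mul1r.
apply: (@le_trans _ _ (N.+1%:R * (e' * (M + `|m|) / N.+1%:R + 2 * K * d))); last first.
  rewrite mulrDr (_ : N.+1%:R * (_ / _) = e' * (M + `|m|)); last by field; lra.
  have -> : N.+1%:R * (2 * K * d) = e / 2 * (K / (K + 1)).
    by rewrite /d; field; lra.
  have -> : e' * (M + `|m|) = e / 2 * ((M + `|m|) / (M + `|m| + 1)).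
    by rewrite /e'; field; lra.
  rewrite -mulrDr [leRHS](_ : e = e / 2 * 2); last by field.
  rewrite ler_pM2l ?divr_gt0//.
  have : K / (K + 1) <= 1 by rewrite ler_pdivrMr// mul1r lerDl.
  have : (M + `|m|) / (M + `|m| + 1) <= 1 by rewrite ler_pdivrMr// mul1r lerDl.
  lra.
apply: subdivision_increment => k kN; rewrite !mul1r.
set b := k.+1%:R / _; set a := k%:R / _.
have a0 : 0 <= a by rewrite divr_ge0.
have baN : b - a = N.+1%:R^-1.
  by rewrite /a /b -mulrBl -natr1 addrAC subrr add0r mul1r.
have ab : a <= b by rewrite -subr_ge0 baN invr_ge0.
have b1 : b <= 1 by rewrite ler_pdivrMr// mul1r ler_nat.
have a01 : 0 <= a <= 1 by rewrite a0 (le_trans ab).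
have b01 : 0 <= b <= 1 by rewrite b1 (le_trans a0).
have aT0 : 0 <= a * T by rewrite mulr_ge0// ltW.
have abT : a * T <= b * T by rewrite ler_pM2r.
have bTT : b * T <= T by rewrite ler_piMl// ltW.
have sub z : bounded_measurable 0 T z -> bounded_measurable (a * T) (b * T) z.
  exact: bounded_measurableS.
have bxs := sub _ (mx T).
have bgc := bounded_measurableB (bg a b) (bounded_measurable_cst a b (g a)).
have bgTc := bounded_measurableM (bounded_measurableB (bgT (a * T) (b * T))
  (bounded_measurable_cst (a * T) (b * T) (g a))) bxs.
have -> : D b - D a =
    T^-1 * integral_on (a * T) (b * T) (fun t => (g (t / T) - g a) * x t)
  - m * integral_on a b (fun r => g r - g a)
  + g a * (T^-1 * ((X (b * T) - m * (b * T)) - (X (a * T) - m * (a * T)))).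
  rewrite integral_onB//; last exact: bounded_measurable_cst.
  rewrite (_ : (fun t => (g (t / T) - g a) * x t) =
    (fun t => g (t / T) * x t - g a * x t)); last by apply/funext => t; ring.
  rewrite integral_onB ?integral_onZ ?integral_on_cst//; last 2 first.
  - exact/sub/bgx.
  - exact: (bounded_measurableM (bounded_measurable_cst _ _ (g a)) bxs).
  rewrite -(primitive_increment (bgx T))// -(primitive_increment (mx T))//.
  rewrite -(primitive_increment (bg 0 1))// /D -/(X _) -/(X _).
  by field; lra.
have part1 : `|T^-1 * integral_on (a * T) (b * T)
    (fun t => (g (t / T) - g a) * x t)| <= e' * M / N.+1%:R.
  rewrite normrM normfV (gtr0_norm T0) mulrC ler_pdivrMr// -baN.
  rewrite [leRHS](_ : _ = e' * M * (b * T - a * T)); last by ring.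
  apply: integral_on_norm_le => // t /andP[at_ tb].
  rewrite normrM ler_pM//; last by apply: xM; exact: le_trans at_.
  rewrite distrC; apply: modN => //; rewrite -baN distrC ger0_norm.
    by rewrite lerB// ler_pdivrMr.
  by rewrite subr_ge0 ler_pdivlMr.
have part2 : `|m * integral_on a b (fun r => g r - g a)| <= e' * `|m| / N.+1%:R.
  rewrite normrM (mulrC e') -mulrA ler_wpM2l// -baN.
  apply: integral_on_norm_le => // r /andP[ar rb].
  by rewrite distrC modN// -baN distrC ger0_norm ?subr_ge0// lerB.
have part3 : `|g a * (T^-1 * ((X (b * T) - m * (b * T)) -
    (X (a * T) - m * (a * T))))| <= 2 * K * d.
  rewrite normrM (_ : 2 * K * d = K * (2 * d)); last by ring.
  apply: ler_pM => //; first exact: gK.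
  rewrite normrM normfV (gtr0_norm T0) mulrC ler_pdivrMr//.
  rewrite (le_trans (ler_normB _ _))// (_ : 2 * d * T = d * T + d * T); last by ring.
  by apply: lerD; apply: growth; rewrite ?aT0 ?bTT ?(le_trans aT0)//= (le_trans abT).
rewrite (le_trans (ler_normD _ _))// lerD//.
rewrite (le_trans (ler_normB _ _))// mulrDr mulrDl lerD//.
Unshelve. all: end_near. Qed.

End WeightedMeans.

(** * The weighted average of the shadowing integrand *)

Section WeightedShadowing.
Context {R : realType}.
Implicit Types (x j w eta tau : R -> R).

Lemma oriented_integral_primitive eta (a b T : R) : bounded_measurable 0 T eta ->
  0 <= a <= T -> 0 <= b <= T ->
  oriented_integral a b eta = integral_on 0 b eta - integral_on 0 a eta.
Proof.
move=> beta /andP[a0 aT] /andP[b0 bT]; rewrite /oriented_integral.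
case: ifPn => [ab|]; first by rewrite (primitive_increment beta).
rewrite -ltNge => /ltW ba.
by rewrite -[RHS]opprB (primitive_increment beta).
Qed.

Lemma bounded_signalM x eta (M N : R) : bounded_signal x M ->
  bounded_signal eta N -> bounded_signal (fun t => x t * eta t) (M * N).
Proof.
move=> [mx xM] [my yN]; split=> [T|t t0]; first exact: bounded_measurableM.
by rewrite normrM ler_pM ?xM ?yN.
Qed.

(** [G'] is the derivative of w(t / T) j(t), which vanishes at both ends of [0, T]:
    hence the first equality, and the absence of boundary terms in the second. *)
Lemma weighted_by_parts eta j j' w w' (T : R) : 0 < T ->
  bounded_measurable 0 T eta ->
  continuous j -> continuous j' -> (forall t : R, 0 < t -> is_derive t 1 j (j' t)) ->
  continuous w -> continuous w' ->
  (forall r : R, 0 < r < 1 -> is_derive r 1 w (w' r)) ->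
  w 0 = 0 -> w 1 = 0 ->
  let G' := fun t => w' (t / T) / T * j t + w (t / T) * j' t in
  integral_on 0 T G' = 0 /\
  integral_on 0 T (fun t => eta t * (w (t / T) * j t)) +
  integral_on 0 T (fun t => integral_on 0 t eta * G' t) = 0.
Proof.
move=> T0 beta cj cj' dj cw cw' dw w0 w1 G'.
pose G t := w (t / T) * j t.
have cwT := continuous_rescale (T := T) cw.
have cw'T := continuous_rescale (T := T) cw'.
have cG : continuous G by move=> t; exact: cvgM (cwT t) (cj t).
have cG' : continuous G'.
  move=> t; apply: cvgD; last exact: cvgM (cwT t) (cj' t).
  by apply: cvgM (cj t); apply: cvgM (cw'T t) (cvg_cst _).
have dG t : 0 < t < T -> is_derive t 1 G (G' t).
  move=> /andP[t0 tT].
  have dwT : is_derive t 1 (w \o (fun t => t * T^-1)) (w' (t / T) * T^-1).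
    apply: is_derive1_comp.
    - by apply: dw; rewrite divr_gt0//= ltr_pdivrMr// mul1r.
    - have := @is_deriveM _ _ id (cst T^-1) t 1 1 0 _ _.
      rewrite /GRing.scale/= mulr0 add0r mulr1; apply.
  have dGt := is_deriveM dwT (dj t t0).
  rewrite (_ : G' t = w (t / T) *: j' t + j t *: (w' (t / T) * T^-1)).
    exact: dGt.
  by rewrite /G' /GRing.scale/=; ring.
have GE t : 0 <= t <= T -> integral_on 0 t G' = G t.
  move=> /andP[t0 tT]; have -> : G t = G t - G 0.
    by rewrite /G mul0r w0 mul0r subr0.
  apply: FTC2_integral_on => // r /andP[r0 rt].
  by apply: dG; rewrite r0 (lt_le_trans rt).
have GT : integral_on 0 T G' = 0.
  by rewrite GE ?(ltW T0) ?lexx// /G divff ?gt_eqF// w1 mul0r.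
split=> //.
have := integration_by_parts_primitives (ltW T0) beta
  (bounded_measurable_continuous 0 T cG').
rewrite GT mulr0 => parts; rewrite -[RHS]parts; congr (_ + _).
by apply: eq_integral_on => t t0T; rewrite GE.
Qed.

(** The scalar content of the theorem: [x] stands for J_u v + J_s, and [j] for the
    observable along the trajectory. Since the integral of [eta] may be unbounded,
    [weighted_mean] does not apply to the term that contains j'; integration by parts
    turns it into terms that only contain [j]. *)
Lemma weighted_shadowing_mean x eta j j' w w' tau (al be h mu c M N K : R) :
  bounded_signal x M -> bounded_signal eta N -> bounded_signal j K ->
  continuous j -> continuous j' -> (forall t : R, 0 < t -> is_derive t 1 j (j' t)) ->
  continuous w -> continuous w' ->
  (forall r : R, 0 < r < 1 -> is_derive r 1 w (w' r)) ->
  w 0 = 0 -> w 1 = 0 -> integral_on 0 1 w = 1 ->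
  (forall T, 0 < T -> 0 <= tau T <= T) ->
  tau T / T @[T --> +oo] --> c ->
  running_mean x T @[T --> +oo] --> al ->
  running_mean (fun t => eta t * j t) T @[T --> +oo] --> be ->
  running_mean eta T @[T --> +oo] --> h ->
  running_mean j T @[T --> +oo] --> mu ->
  running_mean (fun t => w (t / T) *
      (x t - oriented_integral (tau T) t eta * j' t)) T @[T --> +oo] -->
    al + be - h * mu.
Proof.
move=> bx beta bj cj cj' dj cw cw' dw w0 w1 wm tauT tau_c xal ejbe etah jmu.
have cidw : continuous (fun r : R => r * w' r).
  by move=> r; exact: cvgM cvg_id (cw' r).
have iw' : integral_on 0 1 w' = 0.
  have -> : integral_on 0 1 w' = w 1 - w 0 by exact: FTC2_integral_on.
  by rewrite w0 w1 subrr.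
have iidw' : integral_on 0 1 (fun r => r * w' r) = -1.
  have cF : continuous (fun r : R => r * w r).
    by move=> r; exact: cvgM cvg_id (cw r).
  have : integral_on 0 1 (fun r => r * w' r + w r) = 1 * w 1 - 0 * w 0.
    apply: (FTC2_integral_on (F := fun r => r * w r)) => //.
      by move=> r; exact: (cvgD (cidw r) (cw r)).
    move=> r /dw dwr; have := @is_deriveM _ _ id w r 1 1 (w' r) _ dwr.
    rewrite /GRing.scale/= mulr1; apply.
  rewrite integral_onD ?wm; [|exact: bounded_measurable_continuous..].
  by rewrite w1 mulr0 mul0r subrr => /eqP; rewrite addr_eq0 => /eqP.
(* E is the deviation of (H(t) - H(tau)) / T from its linear model h (t - tau) / T; it
   is uniformly small on [0, T]. *)
pose H t := integral_on 0 t eta.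
pose E T t := ((H t - h * t) - (H (tau T) - h * tau T)) / T.
pose Err T := running_mean (fun t => w' (t / T) * (E T t * j t)) T.
have bH T : 0 <= T -> bounded_measurable 0 T H.
  by move=> T0; exact: bounded_measurable_primitive T0 (beta.1 T).
have bE T : 0 < T -> bounded_measurable 0 T (E T).
  move=> T0; apply: bounded_measurableM; last exact: bounded_measurable_cst.
  apply: bounded_measurableB; last exact: bounded_measurable_cst.
  apply: bounded_measurableB; first exact: bH (ltW T0).
  apply: bounded_measurable_continuous => r.
  exact: cvgM (cvg_cst _) cvg_id.
have bwT T := bounded_measurable_continuous 0 T (continuous_rescale (T := T) cw).
have bw'T T := bounded_measurable_continuous 0 T (continuous_rescale (T := T) cw').
have Err0 : Err T @[T --> +oo] --> 0.
  have [_ [L w'L]] := bounded_measurable_continuous 0 1 cw'.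
  have L0 : 0 <= L by apply: le_trans (w'L 0 _); rewrite ?lexx ?ler01.
  have K0 := bounded_signal_ge0 bj.
  apply/cvgrPdist_le => e e0.
  pose d := e / (2 * (L * K + 1)).
  have LK : 0 < L * K + 1 by rewrite ltr_wpDl// mulr_ge0.
  have d0 : 0 < d by rewrite divr_gt0// mulr_gt0.
  near=> T.
  have T0 : 0 < T by near: T; apply: nbhs_pinfty_gt; rewrite num_real.
  have growth : forall t, 0 <= t <= T -> `|H t - h * t| <= d * T.
    by near: T; exact: primitive_linear_growth beta etah _ d0.
  rewrite sub0r normrN /Err /running_mean normrM normfV (gtr0_norm T0).
  rewrite mulrC ler_pdivrMr//.
  apply: (@le_trans _ _ (L * (2 * d * K) * (T - 0))).
    apply: integral_on_norm_le; first exact: ltW.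
      apply: bounded_measurableM => //; apply: bounded_measurableM; first exact: bE.
      exact: bj.1.
    move=> t /[dup] tT /andP[t0 _]; rewrite normrM ler_pM//.
      by rewrite w'L// divr_ge0 ?(ltW T0)//= ler_pdivrMr// mul1r; case/andP: tT.
    rewrite normrM ler_pM//; last exact: bj.2.
    rewrite /E normrM normfV (gtr0_norm T0) ler_pdivrMr//.
    rewrite (le_trans (ler_normB _ _))// (_ : 2 * d * T = d * T + d * T); last by ring.
    by rewrite lerD ?growth// tauT.
  rewrite subr0 ler_pM2r//.
  have -> : L * (2 * d * K) = e * (L * K / (L * K + 1)).
    by rewrite /d; field; rewrite gt_eqF.
  by rewrite ler_piMr ?(ltW e0)// ler_pdivrMr// mul1r lerDl.
pose S1 T := running_mean (fun t => w (t / T) * x t) T.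
pose S2 T := running_mean (fun t => w (t / T) * (eta t * j t)) T.
pose S3 T := running_mean (fun t => (t / T * w' (t / T)) * j t) T.
pose S4 T := running_mean (fun t => w' (t / T) * j t) T.
have lim : S1 T + S2 T + Err T + h * (S3 T - tau T / T * S4 T) @[T --> +oo] -->
    al * 1 + be * 1 + 0 + h * (mu * -1 - c * (mu * 0)).
  have S1c : S1 T @[T --> +oo] --> al * 1.
    by rewrite -wm; exact: weighted_mean cw bx xal.
  have S2c : S2 T @[T --> +oo] --> be * 1.
    by rewrite -wm; exact: weighted_mean cw (bounded_signalM beta bj) ejbe.
  have S3c : S3 T @[T --> +oo] --> mu * -1.
    by rewrite -iidw'; exact: weighted_mean cidw bj jmu.
  have S4c : S4 T @[T --> +oo] --> mu * 0.
    by rewrite -iw'; exact: weighted_mean cw' bj jmu.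
  apply: cvgD; first by apply: cvgD => //; exact: cvgD.
  by apply: cvgMr; apply: cvgB => //; exact: cvgM.
rewrite (_ : al + _ - _ = al * 1 + be * 1 + 0 + h * (mu * -1 - c * (mu * 0))); last by ring.
apply: cvg_trans lim; apply: near_eq_cvg; near=> T.
have T0 : 0 < T by near: T; apply: nbhs_pinfty_gt; rewrite num_real.
have [G'0 parts] := weighted_by_parts T0 (beta.1 T) cj cj' dj cw cw' dw w0 w1.
set G' := (fun t => _ + _) in G'0 parts.
have bG' : bounded_measurable 0 T G'.
  apply: bounded_measurableD; apply: bounded_measurableM => //.
  - apply: bounded_measurableM => //; exact: bounded_measurable_cst.
  - exact: bj.1.
  - exact: bounded_measurable_continuous.
have bHT := bH T (ltW T0).
have bjT := bj.1 T; have betaT := beta.1 T.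
have b1 := bounded_measurableM (bwT T) (bx.1 T).
have b2 := bounded_measurableM (bwT T) (bounded_measurableM betaT bjT).
have b3 := bounded_measurableM (bw'T T) (bounded_measurableM (bE T T0) bjT).
have b4 := bounded_measurableM (bounded_measurable_continuous 0 T
  (continuous_rescale (T := T) cidw)) bjT.
have b5 := bounded_measurableM (bw'T T) bjT.
have b6 := bounded_measurableM betaT (bounded_measurableM (bwT T) bjT).
have b7 := bounded_measurableM bHT bG'.
have bZ (k : R) z : bounded_measurable 0 T z -> bounded_measurable 0 T (fun t => k * z t).
  exact/bounded_measurableM/bounded_measurable_cst.
have b12 := bounded_measurableD b1 b2.
have b123 := bounded_measurableD b12 b3.
have b45 := bounded_measurableB b4 (bZ (tau T / T) _ b5).
have b67 := bounded_measurableD b6 b7.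
have b12345 := bounded_measurableD b123 (bZ h _ b45).
have b67G := bounded_measurableB b67 (bZ (H (tau T)) _ bG').
(* The subtracted combination of the last line has integral 0, by parts. *)
have -> : running_mean (fun t => w (t / T) *
      (x t - oriented_integral (tau T) t eta * j' t)) T =
    T^-1 * integral_on 0 T (fun t =>
      (w (t / T) * x t + w (t / T) * (eta t * j t) +
       w' (t / T) * (E T t * j t) +
       h * (t / T * w' (t / T) * j t - tau T / T * (w' (t / T) * j t))) -
      (eta t * (w (t / T) * j t) + H t * G' t - H (tau T) * G' t)).
  congr (_ * _); apply: eq_integral_on => t tT.
  rewrite (oriented_integral_primitive betaT (tauT T T0) tT).
  by rewrite -/(H t) -/(H (tau T)) /E /G'; field; lra.
rewrite (integral_onB b12345 b67G) (integral_onD b123 (bZ h _ b45)).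
rewrite (integral_onD b12 b3) (integral_onD b1 b2).
rewrite (integral_onZ _ b45) (integral_onB b4 (bZ _ _ b5)) (integral_onZ _ b5).
rewrite (integral_onB b67 (bZ _ _ bG')) (integral_onZ _ bG') (integral_onD b6 b7).
rewrite parts G'0 /S1 /S2 /S3 /S4 /Err /running_mean /integral_on; ring.
Unshelve. all: end_near. Qed.

End WeightedShadowing.

(** * One-sided derivatives and continuous extensions *)

Section OneSidedDerivatives.
Context {R : realType}.

Lemma unif_continuous_is_continuous (A B : uniformType) (g : A -> B) :
  unif_continuous g -> continuous g.
Proof.
move=> ug x; apply/cvg_app_entourageP => E /ug entE.
by have := nbhs_entourage x entE; apply: filterS => y /xsectionP.
Qed.

Lemma has_deriv_within_continuous {V : normedModType R} (D : set R)
    (g g' : R -> V) :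
  (forall t, D t -> has_deriv_within D g t (g' t)) -> {within D, continuous g}.
Proof.
move=> dg; apply/subspace_continuousP => t Dt.
apply/cvgrPdist_le => e e0.
have L0 : 0 < `|g' t| + 1 by rewrite ltr_wpDl.
have [d /= d0 dP] : \forall h \near (0 : R), h != 0 -> D (t + h) ->
    `|g' t - h^-1 *: (g (t + h) - g t)| <= 1.
  by have /cvgrPdist_le := dg t Dt; apply.
rewrite near_withinE; near=> r => Dr; rewrite /from_subspace.
have [->|rt] := eqVneq r t; first by rewrite subrr normr0 ltW.
pose h := r - t.
have h0 : h != 0 by rewrite subr_eq0.
have rE : r = t + h by rewrite addrC subrK.
have hd : `|h| < d.
  by rewrite distrC; near: r; exists d.
have he : `|h| * (`|g' t| + 1) <= e.
  rewrite -ler_pdivlMr// distrC ltW//; near: r.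
  by exists (e / (`|g' t| + 1)) => //=; rewrite divr_gt0.
apply: le_trans he.
have -> : g t - g r = - (h *: (h^-1 *: (g (t + h) - g t))).
  by rewrite scalerA divff// scale1r opprB rE.
rewrite normrN normrZ ler_wpM2l//.
rewrite -[X in `|X|](subKr (g' t)) (le_trans (ler_normB _ _))// lerD2l.
by apply: dP; rewrite -?rE//= sub0r normrN.
Unshelve. all: end_near. Qed.

Lemma has_deriv_within_is_derive {V : normedModType R} (D : set R) (g : R -> V)
    (t : R) (l : V) : nbhs t D -> has_deriv_within D g t l -> is_derive t 1 g l.
Proof.
move=> [d /= d0 dD] dg.
suff cvl : h^-1 *: ((g \o shift t) (h *: (1 : R)) - g t) @[h --> 0^'] --> l.
  by apply: DeriveDef; [apply/cvg_ex; exists l | exact: cvg_lim cvl].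
move=> U lU; have /= := dg U lU; rewrite /nbhs/= => dgU.
have Dh : \forall h \near (0 : R)^', D (t + h).
  exists d => //= h; rewrite /= sub0r normrN => hd _; apply: dD.
  by rewrite /= opprD addNKr normrN.
apply: filterS2 Dh dgU => h Dh /(_ Dh) /=.
by rewrite [h *: 1]mulr1 [h + t]addrC.
Qed.

(** The trajectory, the shadowing direction and the weight are only known on closed
    intervals; composing them with a retraction extends them to continuous functions
    on the line, which spares one-sided limits. *)
Lemma continuous_retraction {V : topologicalType} (D : set R) (rho : R -> R)
    (g : R -> V) : continuous rho -> (forall t, D (rho t)) ->
  {within D, continuous g} -> continuous (g \o rho).
Proof.
move=> crho Drho /subspace_continuousP cg t U gU.
have near_t : \forall r \near t, D (rho r) -> U (g (rho r)).
  exact: crho t _ (cg _ (Drho t) U gU).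
by apply: filterS near_t => r /(_ (Drho r)).
Qed.

Definition nonneg_part (t : R) : R := Num.max t 0.

Lemma nonneg_part_ge0 t : 0 <= nonneg_part t.
Proof. by rewrite le_max lexx orbT. Qed.

Lemma nonneg_part_id t : 0 <= t -> nonneg_part t = t.
Proof. exact: max_l. Qed.

Lemma nonneg_part_continuous : continuous nonneg_part.
Proof.
by move=> t; apply: (@continuous_max _ _ id (cst 0) t);
  [exact: cvg_id|exact: cst_continuous].
Qed.

Definition unit_clamp (t : R) : R := Num.min (nonneg_part t) 1.

Lemma unit_clamp_itv t : 0 <= unit_clamp t <= 1.
Proof. by rewrite le_min nonneg_part_ge0 ler01 ge_min lexx orbT. Qed.

Lemma unit_clamp_id t : 0 <= t <= 1 -> unit_clamp t = t.
Proof.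
by move=> /andP[t0 t1]; rewrite /unit_clamp nonneg_part_id// min_l.
Qed.

Lemma unit_clamp_continuous : continuous unit_clamp.
Proof.
by move=> t; apply: (@continuous_min _ _ nonneg_part (cst 1) t);
  [exact: nonneg_part_continuous|exact: cst_continuous].
Qed.

Lemma eq_running_mean (x y : R -> R) : (forall t, 0 <= t -> x t = y t) ->
  running_mean x = running_mean y.
Proof.
move=> xy; apply/funext => T; congr (_ * _).
by apply: eq_integral_on => t /andP[t0 _]; exact: xy.
Qed.

Lemma bounded_signal_time (x : R -> R) : locally_integrable_in_time x ->
  bounded_in_time x -> exists M, bounded_signal x M.
Proof.
move=> ix [M xM]; exists M; split=> // T.
apply: (@bounded_measurableS _ 0 `|T|) => //; first exact: ler_norm.
split; last by exists M => t /andP[t0 _]; exact: xM.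
by have /measurable_int/measurable_EFinP := ix _ (normr_ge0 T).
Qed.

Lemma bounded_signal_continuous (x : R -> R) M : continuous x ->
  (forall t, 0 <= t -> `|x t| <= M) -> bounded_signal x M.
Proof. by move=> cx xM; split=> // T; exact: bounded_measurable_continuous. Qed.

End OneSidedDerivatives.

(** * The observable along a trajectory *)

Section Partials.
Context {R : realType} {n : nat}.
Implicit Types (J : 'rV[R]_n -> R -> R) (p q : R -> 'rV[R]_n).

(** Only the continuity of J_u h for each fixed h is assumed; expanding q(t) in the
    canonical basis gives joint continuity. *)
Lemma d_u_continuous J s p q : unif_continuous_partials J ->
  continuous p -> continuous q -> continuous (fun t => d_u J (p t) s (q t)).
Proof.
move=> [_ _ ucJ _] cp cq.
have -> : (fun t => d_u J (p t) s (q t)) =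
    (fun t => \sum_(i < n) q t 0 i * d_u J (p t) s 'e_i).
  apply/funext => t; rewrite {1}[q t]row_sum_delta /d_u linear_sum.
  by apply: eq_bigr => i _; rewrite linearZ.
move=> t; apply: cvg_big => [|i _]; first exact: add_continuous.
apply: cvgM.
  exact: (@cvg_comp _ _ _ q (fun M => M 0 i) _ _ _ (cq t) (@coord_continuous _ _ _ 0 i (q t))).
apply: (@continuous_comp _ _ _ (fun t => (p t, s))
  (fun z : 'rV[R]_n * R => d_u J z.1 z.2 'e_i) t).
  exact: cvg_pair (cp t) (cvg_cst _).
exact: (unif_continuous_is_continuous (ucJ 'e_i)).
Qed.

Lemma d_s_continuous J s p : unif_continuous_partials J ->
  continuous p -> continuous (fun t => d_s J (p t) s).
Proof.
move=> [_ _ _ ucJ] cp t.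
apply: (@continuous_comp _ _ _ (fun t => (p t, s))
  (fun z : 'rV[R]_n * R => d_s J z.1 z.2) t).
  exact: cvg_pair (cp t) (cvg_cst _).
exact: (unif_continuous_is_continuous ucJ).
Qed.

Lemma is_derive_along J s p (t : R) (l : 'rV[R]_n) : unif_continuous_partials J ->
  is_derive t 1 p l -> is_derive t 1 (fun r => J (p r) s) (d_u J (p t) s l).
Proof.
move=> [dJ _ _ _] [dp pl].
have {}dp : differentiable p t by apply/derivable1_diffP.
have dJp : differentiable ((fun y => J y s) \o p) t.
  exact: differentiable_comp.
apply: DeriveDef; first exact/derivable1_diffP.
rewrite -[X in 'D_1 X t]/((fun y => J y s) \o p) (deriveE _ dJp) diff_comp//.
by rewrite /= /d_u -pl deriveE.
Qed.

End Partials.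

(** * The derivative of the long-time average *)

Theorem theorem1 (R : realType) (n : nat)
  (f : 'rV[R]_n -> R -> 'rV[R]_n) (J : 'rV[R]_n -> R -> R)
  (f_smooth : smooth (fun p : 'rV[R]_n * R => f p.1 p.2))
  (J_partials : unif_continuous_partials J)
  (f_ergodic : ergodic f J)
  (f_hyperbolic : uniformly_hyperbolic f)
  (* U s t is u(t; s) *)
  (U : R -> R -> 'rV[R]_n)
  (U_traj : forall s, trajectory f s (U s))
  (s : R)
  (f_bounded : bounded_in_time (fun t => f (U s t) s))
  (J_bounded : bounded_in_time (fun t => J (U s t) s))
  (Ju_bounded : exists M : R, forall t h, 0 <= t ->
     `|d_u J (U s t) s h| <= M * `|h|)
  (Js_bounded : bounded_in_time (fun t => d_s J (U s t) s))
  (v : R -> 'rV[R]_n) (eta : R -> R)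
  (v_eta : shadowing_pair f s (U s) v eta)
  (avg_Juv : has_time_average (fun t => d_u J (U s t) s (v t)))
  (avg_Js : has_time_average (fun t => d_s J (U s t) s))
  (avg_etaJ : has_time_average (fun t => eta t * J (U s t) s))
  (avg_eta : has_time_average eta)
  (avg_J : has_time_average (fun t => J (U s t) s))
  (J_avg_derivable :
     derivable (fun s' => time_average (fun t => J (U s' t) s')) s 1)
  (J_avg_formula :
     derive1 (fun s' => time_average (fun t => J (U s' t) s')) s =
       time_average (fun t => d_u J (U s t) s (v t))
       + time_average (fun t => d_s J (U s t) s)
       + time_average (fun t => eta t * J (U s t) s)
       - time_average eta * time_average (fun t => J (U s t) s))
  (w : R -> R) (tau : R -> R)
  (w_C1 : C1_on `[0, 1] w)
  (w_ends : w 0 = 0 /\ w 1 = 0)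
  (w_mass : (\int[lebesgue_measure]_(r in `[0, 1]) w r)%R = 1)
  (tau_bounds : forall T, 0 < T -> 0 <= tau T <= T)
  (tau_limit : cvg (tau T / T @[T --> +oo])) :
  running_mean (fun t => w (t / T) *
      (d_u J (U s t) s (v_check f s (U s) v eta (tau T) t) + d_s J (U s t) s)) T
    @[T --> +oo]
  --> derive1 (fun s' => time_average (fun t => J (U s' t) s')) s.
Proof.
have [v_bounded eta_bounded eta_int dv] := v_eta.
have [Mv vM] := v_bounded; have [MJ JM] := J_bounded.
have [MJu JuM] := Ju_bounded; have [MJs JsM] := Js_bounded.
have [w' [dw cw']] := w_C1; have [w0 w1] := w_ends.
have [Me beta] := bounded_signal_time eta_int eta_bounded.
have nonneg_itv t : (`[0, +oo[%classic : set R) (nonneg_part t).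
  by rewrite /= in_itv/= nonneg_part_ge0.
have clamp_itv t : (`[0, 1]%classic : set R) (unit_clamp t).
  by rewrite /= in_itv/= unit_clamp_itv.
(* p, q, omega and omega' extend the trajectory, the shadowing direction, the weight
   and its derivative continuously to the line. *)
pose p t := U s (nonneg_part t); pose q t := v (nonneg_part t).
have cp : continuous p.
  apply: (continuous_retraction nonneg_part_continuous nonneg_itv).
  exact: has_deriv_within_continuous (U_traj s).
have cq : continuous q.
  apply: (continuous_retraction nonneg_part_continuous nonneg_itv).
  apply: has_deriv_within_continuous => t; rewrite /= in_itv/= andbT.
  exact: dv.
pose omega r := w (unit_clamp r); pose omega' r := w' (unit_clamp r).
have comega : continuous omega.
  apply: (continuous_retraction unit_clamp_continuous clamp_itv).
  exact: has_deriv_within_continuous dw.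
have comega' : continuous omega'.
  exact: (continuous_retraction unit_clamp_continuous clamp_itv cw').
have domega (r : R) : 0 < r < 1 -> is_derive r 1 omega (omega' r).
  move=> r01; have r01' : 0 <= r <= 1 by case/andP: r01 => /ltW -> /ltW ->.
  have nbhs_r : nbhs r (`[0, 1]%classic : set R).
    have [r0 r1] := andP r01; near=> y; rewrite /= in_itv/=; apply/andP.
    by split; apply: ltW; near: y; [exact: lt_nbhsr | exact: lt_nbhsl].
  rewrite /omega' (unit_clamp_id r01').
  apply: (near_eq_is_derive (f := w)); last first.
    by apply: has_deriv_within_is_derive nbhs_r (dw r _); rewrite /= in_itv.
  apply: filterS nbhs_r => y; rewrite /= in_itv/= => y01.
  by rewrite /omega unit_clamp_id.
pose j t := J (p t) s; pose j' t := d_u J (p t) s (f (p t) s).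
have dj (t : R) : 0 < t -> is_derive t 1 j (j' t).
  move=> t0; have nbhs_t : nbhs t (`[0, +oo[%classic : set R).
    by near=> y; rewrite /= in_itv/= andbT ltW//; near: y; exact: lt_nbhsr.
  apply: is_derive_along J_partials _.
  apply: (near_eq_is_derive (f := U s)).
    apply: filterS nbhs_t => y; rewrite /= in_itv/= andbT => y0.
    by rewrite /p nonneg_part_id.
  apply: has_deriv_within_is_derive nbhs_t _.
  by rewrite /p (nonneg_part_id (ltW t0)); apply: U_traj; rewrite /= in_itv/= andbT ltW.
have cj : continuous j.
  have [dJ _ _ _] := J_partials.
  move=> t; apply: (@continuous_comp _ _ _ p (fun y => J y s)); first exact: cp.
  exact: (differentiable_continuous (dJ (p t) s)).
have cf : continuous (fun t => f (p t) s).
  move=> t; apply: (@continuous_comp _ _ _ (fun t => (p t, s))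
    (fun z : 'rV[R]_n * R => f z.1 z.2) t); first exact: cvg_pair (cp t) (cvg_cst _).
  exact: (f_smooth 0%N).
have cj' : continuous j' by exact: d_u_continuous.
have pE t : 0 <= t -> p t = U s t by move=> t0; rewrite /p nonneg_part_id.
have qE t : 0 <= t -> q t = v t by move=> t0; rewrite /q nonneg_part_id.
pose y t := d_u J (p t) s (q t); pose z t := d_s J (p t) s.
have cy : continuous y by exact: d_u_continuous.
have cz : continuous z by exact: d_s_continuous.
have yM t : 0 <= t -> `|y t| <= `|MJu| * Mv.
  move=> t0; rewrite /y pE// qE//; apply: le_trans (JuM _ _ t0) _.
  apply: (@le_trans _ _ (`|MJu| * `|v t|)); first by rewrite ler_wpM2r ?ler_norm.
  by rewrite ler_wpM2l ?vM.
have bx : bounded_signal (fun t => y t + z t) (`|MJu| * Mv + MJs).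
  apply: bounded_signal_continuous => [t|t t0]; first exact: cvgD (cy t) (cz t).
  by rewrite (le_trans (ler_normD _ _))// lerD ?yM// /z pE// JsM.
have bj : bounded_signal j MJ.
  by apply: bounded_signal_continuous => // t t0; rewrite /j pE// JM.
have xmean : running_mean (fun t => y t + z t) T @[T --> +oo] -->
    time_average (fun t => d_u J (U s t) s (v t)) +
    time_average (fun t => d_s J (U s t) s).
  rewrite (_ : (fun T => _) = (fun T => running_mean y T + running_mean z T)).
    apply: cvgD.
      rewrite (@eq_running_mean _ y (fun t => d_u J (U s t) s (v t))).
        exact: avg_Juv.
      by move=> t t0; rewrite /y pE// qE.
    rewrite (@eq_running_mean _ z (fun t => d_s J (U s t) s)).
      exact: avg_Js.
    by move=> t t0; rewrite /z pE.
  apply/funext => T; rewrite /running_mean -mulrDr; congr (_ * _).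
  by apply: integral_onD; exact: bounded_measurable_continuous.
have etajmean : running_mean (fun t => eta t * j t) T @[T --> +oo] -->
    time_average (fun t => eta t * J (U s t) s).
  rewrite (@eq_running_mean _ _ (fun t => eta t * J (U s t) s)).
    exact: avg_etaJ.
  by move=> t t0; rewrite /j pE.
have jmean : running_mean j T @[T --> +oo] -->
    time_average (fun t => J (U s t) s).
  rewrite (@eq_running_mean _ _ (fun t => J (U s t) s)).
    exact: avg_J.
  by move=> t t0; rewrite /j pE.
have := weighted_shadowing_mean bx beta bj cj cj' dj comega comega' domega _ _ _
  tau_bounds tau_limit xmean etajmean avg_eta jmean.
rewrite J_avg_formula => lim_weighted; apply: cvg_trans (lim_weighted _ _ _).
- apply: near_eq_cvg; near=> T.
  have T0 : 0 < T by near: T; apply: nbhs_pinfty_gt; rewrite num_real.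
  congr (_ * _); apply: eq_integral_on => t /andP[t0 tT].
  have tT01 : 0 <= t / T <= 1.
    by rewrite divr_ge0 ?(ltW T0)//= ler_pdivrMr// mul1r.
  rewrite /omega unit_clamp_id// /y /z /j' pE// qE// /v_check.
  by rewrite /d_u linearB [in RHS]addrAC (linearZ_LR _ _ (f _ _)).
- by rewrite /omega unit_clamp_id ?lexx ?ler01.
- by rewrite /omega unit_clamp_id ?lexx ?ler01.
- rewrite -[RHS]w_mass; apply: eq_integral_on => r r01.
  by rewrite /omega unit_clamp_id.
Unshelve. all: end_near. Qed.
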